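(* Let $n\ge 1$, let $S\subseteq\mathbb{F}_2^n$ be a Sidon set, let $s=|S|$, and assume that $S$ has affine dimension $n$ and $s>1$. \begin{enumerate} \item If $\mathrm{Cay}(\gamma_S)$ has exactly $2$ distinct eigenvalues, then $n\in\{1,2,4\}$, and if $n\neq 1$ then $S$ is a $k$-cover with $(n,s)\in\{(2,3),(4,6)\}$. \item If $\mathrm{Cay}(\gamma_S)$ has $3$ or more distinct eigenvalues, then $S$ is a $k$-cover if and only if $\mathrm{Cay}(\gamma_S)$ is strongly regular and $S$ is separable. \item If $S$ is a $k$-cover (for the positive integer $k$) and $\mathrm{Cay}(\gamma_S)$ is not complete, then $\mathrm{Cay}(\gamma_S)$ is strongly regular with parameters \[ \left(2^n,\ \binom{s}{2},\ \frac{3k}{2}\cdot\frac{2^{n+1}+s^2(s-3)}{s(s-1)},\ \frac{3k}{2}\,s\right), \] or equivalently \[ \left(2^n,\ \binom{s}{2},\ \frac{(s-2)(s^3-3s^2+2^{n+1})}{4(2^n-s)},\ \frac{s^2(s-1)(s-2)}{4(2^n-s)}\right). \] \end{enumerate}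
   Context: A set $S\subseteq\mathbb{F}_2^n$ is a Sidon set if whenever $a+b=c+d$ with $a,b,c,d\in S$, $a\neq b$, $c\neq d$, then $\{a,b\}=\{c,d\}$. For $p\in\mathbb{F}_2^n\setminus S$, the exclude multiplicity $\mathrm{mult}_S(p)$ is the number of $3$-element subsets $\{x,y,z\}\subseteq S$ with $x+y+z=p$. A Sidon set $S$ is a $k$-cover if there is an integer $k>0$ such that $\mathrm{mult}_S(p)=k$ for every $p\in\mathbb{F}_2^n\setminus S$. A set $S$ is separable if there is an affine hyperplane $H$ of $\mathbb{F}_2^n$ with $|H\cap S|=|S|/2$. A subset $\{x_1,\dots,x_m\}$ is affinely independent if no $x_i$ lies in the affine span (set of sums of an odd number of elements) of the others; $S$ has affine dimension $d$ if $d+1$ is the largest size of an affinely independent subset of $S$. Define $\gamma_S:\mathbb{F}_2^n\to\mathbb{F}_2$ by $\gamma_S(a)=1$ if $a\neq 0$ and $(a+S)\cap S\neq\emptyset$, and $\gamma_S(a)=0$ otherwise. For a Boolean function $f:\mathbb{F}_2^n\to\mathbb{F}_2$, the Cayley graph $\mathrm{Cay}(f)$ has vertex set $\mathbb{F}_2^n$ and edge set $\{\{u,v\}: f(u+v)=1\}$. Eigenvalues of a graph are those of its adjacency matrix. A graph is strongly regular with parameters $(v,k,\lambda,\mu)$ if it is $k$-regular on $v$ vertices and any two adjacent (resp. non-adjacent) distinct vertices have exactly $\lambda$ (resp. $\mu$) common neighbours. *)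

(* Defs.v *)
From HB Require Import structures.
From mathcomp Require Import all_boot all_order all_algebra.
Set Implicit Arguments.
Unset Strict Implicit.
Unset Printing Implicit Defensive.
Import GRing.Theory.
Local Open Scope ring_scope.

Notation "''F2^' n" := 'rV['F_2]_n
  (at level 8, n at level 2, format "''F2^' n") : type_scope.

Definition Sidon (n : nat) (S : {set 'F2^n}) : Prop :=
  forall a b c d, a \in S -> b \in S -> c \in S -> d \in S ->
    a != b -> c != d -> a + b = c + d -> [set a; b] = [set c; d].

Definition mult (n : nat) (S : {set 'F2^n}) (p : 'F2^n) : nat :=
  #|[set B : {set 'F2^n} |
      [&& B \subset S, #|B| == 3%N & \sum_(x in B) x == p]]|.

Definition k_cover (n : nat) (k : nat) (S : {set 'F2^n}) : Prop :=
  [/\ Sidon S, (0 < k)%N & forall p, p \notin S -> mult S p = k].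

Definition affine_hyperplane (n : nat) (H : {set 'F2^n}) : Prop :=
  exists (U : {vspace 'F2^n}) (v : 'F2^n),
    (\dim U).+1 = n /\ H = [set x | x - v \in U].

Definition separable (n : nat) (S : {set 'F2^n}) : Prop :=
  exists H : {set 'F2^n}, affine_hyperplane H /\ (#|H :&: S|.*2 = #|S|)%N.

(* Equal summands cancel in pairs in characteristic 2, without changing the
   parity of the number of summands, so sums of distinct elements suffice. *)
Definition affine_span (n : nat) (A : {set 'F2^n}) : {set 'F2^n} :=
  [set \sum_(x in B) x | B : {set 'F2^n} in powerset A & odd #|B|].

Definition affinely_independent (n : nat) (A : {set 'F2^n}) : bool :=
  [forall x in A, x \notin affine_span (A :\ x)].

Definition has_affine_dim (n : nat) (S : {set 'F2^n}) (d : nat) : Prop :=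
  (\max_(A : {set 'F2^n} | (A \subset S) && affinely_independent A) #|A|)%N
    = d.+1.

Definition gamma (n : nat) (S : {set 'F2^n}) (a : 'F2^n) : 'F_2 :=
  if (a != 0) && ([set a + x | x in S] :&: S != set0) then 1 else 0.

Definition Cay (n : nat) (f : 'F2^n -> 'F_2) : rel 'F2^n :=
  fun u v => f (u + v) == 1.

Lemma Cay_gamma_sym (n : nat) (S : {set 'F2^n}) : symmetric (Cay (gamma S)).
Proof. by move=> u v; rewrite /Cay addrC. Qed.

Lemma Cay_gamma_irr (n : nat) (S : {set 'F2^n}) : irreflexive (Cay (gamma S)).
Proof.
move=> u; rewrite /Cay /gamma.
suff -> : u + u = 0 by rewrite eqxx.
by apply/rowP => i; rewrite !mxE -mulr2n -mulr_natr pchar_Fp_0 ?mulr0.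
Qed.

Definition adjacency_mx (R : fieldType) (T : finType) (e : rel T)
    : 'M[R]_#|T| :=
  \matrix_(i, j) (e (enum_val i) (enum_val j))%:R.

Definition has_num_eigenvalues (R : fieldType) (m : nat) (A : 'M[R]_m)
    (d : nat) : Prop :=
  exists s : seq R,
    [/\ uniq s, size s = d & forall a : R, eigenvalue A a = (a \in s)].

Definition complete_graph (T : finType) (e : rel T) : Prop :=
  forall x y, x != y -> e x y.

Definition common_neighbours (T : finType) (e : rel T) (x y : T) : {set T} :=
  [set z | e x z && e y z].

Definition strongly_regular (T : finType) (e : rel T) (v k lam mu : nat)
    : Prop :=
  [/\ #|T| = v,
      forall x, #|[set y | e x y]| = k,
      forall x y, x != y -> e x y -> #|common_neighbours e x y| = lam
    & forall x y, x != y -> ~~ e x y -> #|common_neighbours e x y| = mu].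

(* Main.v *)
Require Import Defs.
From HB Require Import structures.
From mathcomp Require Import all_boot all_order all_algebra.
From mathcomp Require Import zify ring lra.
Set Implicit Arguments.
Unset Strict Implicit.
Unset Printing Implicit Defensive.
Import Order.TTheory GRing.Theory Num.Theory.
Local Open Scope ring_scope.

(* For u in F_2^n put a(u) = \sum_(x in S) (-1)^(u.x) and let b(u) be the
   Fourier transform of the support D of gamma_S, so that the b(u) are the
   eigenvalues of Cay(gamma_S).  The Sidon property gives 2 b = a^2 - s, and it
   shows that #{z in S | p + z in D} is s - 1 for p in S and 3 mult_S(p)
   otherwise.  Affine dimension n means that a(u)^2 <> s^2 for u <> 0.  Hence,
   taking Fourier transforms, S is a k-cover for some k > 0 iff there is a
   constant theta such that a(u) = 0 or b(u) = theta for every u <> 0.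
   Separability means that a vanishes at some u <> 0, and strong regularity gives
   a quadratic equation satisfied by all b(u), u <> 0, whose other root is theta.
   If b is constant on u <> 0, then D is the complement of 0 and a(u)^2 = s - 2
   is a square t^2, so that counting D gives t^4 + 3 t^2 + 4 = 2^(n+1), where
   the left-hand side is (t^2 + t + 2)(t^2 - t + 2). *)

(** * Characteristic 2 arithmetic and the dot product on F_2^n *)

Section BinarySpace.
Variable n : nat.
Implicit Types (u x y z p : 'F2^n) (A B S : {set 'F2^n}).

Lemma addxx x : x + x = 0.
Proof. by rewrite -mulr2n -scaler_nat pchar_Zp // scale0r. Qed.

Lemma addxK x y : x + y + y = x.
Proof. by rewrite -addrA addxx addr0. Qed.

Lemma addKx x y : y + (y + x) = x.
Proof. by rewrite addrA addxx add0r. Qed.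

Lemma addx_eq0 x y : (x + y == 0) = (x == y).
Proof. by rewrite -[in RHS]subr_eq0 (addr0_eq (addxx y)). Qed.

Lemma bij_addx x : bijective (+%R x).
Proof. by exists (+%R x) => y; rewrite addKx. Qed.

Lemma card_F2V : #|{: 'F2^n}| = (2 ^ n)%N.
Proof. by rewrite card_mx mul1n card_Fp. Qed.

Definition dot u x : 'F_2 := (u *m x^T) 0 0.

Lemma dotE u x : dot u x = \sum_i u 0 i * x 0 i.
Proof. by rewrite /dot mxE; apply: eq_bigr => i _; rewrite mxE. Qed.

Lemma dotC u x : dot u x = dot x u.
Proof. by rewrite !dotE; apply: eq_bigr => i _; rewrite mulrC. Qed.

Lemma dotDr u x y : dot u (x + y) = dot u x + dot u y.
Proof. by rewrite /dot linearD mulmxDr mxE. Qed.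

Lemma dot0r u : dot u 0 = 0.
Proof. by rewrite /dot trmx0 mulmx0 mxE. Qed.

Lemma dot_sumr u B : dot u (\sum_(x in B) x) = \sum_(x in B) dot u x.
Proof. by apply: (big_morph (dot u)); [exact: dotDr | exact: dot0r]. Qed.

Lemma dot_neq0 u : u != 0 -> exists x, dot u x = 1.
Proof.
case/rV0Pn => i ui; exists (delta_mx 0 i).
rewrite dotE (bigD1 i) //= big1 ?addr0 => [|j ji].
  rewrite mxE !eqxx mulr1; apply/val_inj.
  by move: ui; case: (u 0 i) => [[|[|m]]].
by rewrite mxE (negPf ji) andbF mulr0.
Qed.

Lemma F2_neq0 (a : 'F_2) : (a != 0) = (a == 1).
Proof. by case: a => [[|[|m]]]. Qed.

(** * Sums of two and three points of a Sidon set; affine dimension *)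

Definition supp (f : 'F2^n -> 'F_2) : {set 'F2^n} := [set x | f x == 1].

Lemma CayE f x y : Cay f x y = (x + y \in supp f).
Proof. by rewrite inE. Qed.

Lemma in_supp_gamma S p :
  (p \in supp (gamma S)) = (p != 0) && [exists x in S, p + x \in S].
Proof.
rewrite inE /gamma; case: (p == 0) => //=.
suff -> : ([set p + x | x in S] :&: S != set0) = [exists x in S, p + x \in S].
  by case: ifP.
apply/set0Pn/exists_inP => [[y]|[x xS pxS]].
  by rewrite inE => /andP[/imsetP[x xS ->] pxS]; exists x.
by exists (p + x); rewrite inE imset_f.
Qed.

(** The Sidon property leaves at most one unordered pair with sum [p], and each of its two elements
    is counted. *)
Lemma card_pairs S p : Sidon S -> p != 0 ->
  #|[set x in S | p + x \in S]| = ((p \in supp (gamma S)).*2)%N.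
Proof.
move=> hS p0; rewrite in_supp_gamma p0 /=.
case: exists_inP => [[x xS pxS]|nex]; last first.
  apply/eqP; rewrite cards_eq0; apply/eqP/setP => x; rewrite !inE.
  by apply/negP => /andP[xS pxS]; apply: nex; exists x.
have npx y : y != p + y by rewrite -addx_eq0 addrCA addxx addr0.
suff -> : [set x0 in S | p + x0 \in S] = [set x; p + x] by rewrite cards2 npx.
apply/setP => y; rewrite inE; apply/andP/idP => [[yS pyS]|].
  have <- : [set y; p + y] = [set x; p + x]; last by rewrite set21.
  by apply: hS; rewrite ?npx // !(addrCA _ p) !addxx.
by case/set2P => ->; rewrite ?addKx.
Qed.

Lemma card_supp_gamma_pos S : (1 < #|S|)%N -> exists p, p \in supp (gamma S).
Proof.
case/card_gt1P => a [b [aS bS ab]]; exists (a + b).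
rewrite in_supp_gamma addx_eq0 ab /=.
by apply/exists_inP; exists b; rewrite ?addxK.
Qed.

Lemma triple_of S p z (B : {set 'F2^n}) :
    B \subset S -> #|B| = 3 -> \sum_(x in B) x = p -> z \in B ->
  exists x y, [/\ x != y, x \in S, y \in S, x + y = p + z
                & B = z |: [set x; y]].
Proof.
move=> BS cB sB zB.
have : #|B :\ z| == 2 by have := cardsD1 z B; rewrite zB cB add1n => -[<-].
case/cards2P => x [y [xy Ezxy]]; exists x, y.
have eB : B = z |: [set x; y] by rewrite -Ezxy setD1K.
have [xB yB] : x \in B /\ y \in B by rewrite eB !inE !eqxx !orbT.
rewrite !(subsetP BS) //; split=> //.
rewrite -sB (bigD1 z) //= [z + _]addrC addxK.
rewrite (eq_bigl (mem [set x; y])) => [|t]; last first.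
  by rewrite -Ezxy !inE andbC.
by rewrite big_setU1 ?big_set1 // inE.
Qed.

(** Every [z] in [S] other than [p] qualifies, as [p + z] is then a sum of two distinct points of
    [S]; [z = p] fails because 0 is outside the support. *)
Lemma card_triples_in S p : p \in S ->
  #|[set z in S | p + z \in supp (gamma S)]| = #|S|.-1.
Proof.
move=> pS; rewrite (cardsD1 p S) pS /=; apply: eq_card => z.
rewrite in_setD1 in_set in_supp_gamma addx_eq0 eq_sym andbC -andbA.
case: eqP => //= _; rewrite andbC; case zS: (z \in S) => //=.
by apply/exists_inP; exists z; rewrite ?addxK.
Qed.

(** Double counting of incidences between points and triples with sum [p]: by the Sidon property a
    point [z] lies in one such triple if [p + z] is in the support, and in none otherwise. *)
Lemma card_triples_notin S p : Sidon S -> p \notin S ->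
  #|[set z in S | p + z \in supp (gamma S)]| = (3 * mult S p)%N.
Proof.
move=> hS pS; rewrite /mult; set M := [set B : {set _} | _].
have MP B : B \in M -> [/\ B \subset S, #|B| = 3 & \sum_(x in B) x = p].
  by rewrite inE => /and3P[-> /eqP-> /eqP->].
have through z : z \in S ->
    #|[set B in M | z \in B]| = (p + z \in supp (gamma S)).
  move=> zS; case: (boolP (p + z \in _)) => [|ngz].
    rewrite in_supp_gamma => /andP[pz /exists_inP[x xS yS]].
    set y := p + z + x in yS.
    have xy : x != y.
      by rewrite eq_sym -addx_eq0 /y addxK.
    (* A coincidence among [z], [x], [y] would put [p] itself in [S]. *)
    have zx : z != x.
      by apply: contraNneq pS => zx; move: yS; rewrite /y zx addxK.
    have zy : z != y.
      apply: contraNneq pS => zy.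
      suff -> : p = x by [].
      apply/eqP; rewrite -addx_eq0 -(addxx z) {2}zy /y addrAC.
      by rewrite [z + _]addrC addxK.
    have eqxy : x + y = p + z by rewrite addrC addxK.
    apply/eqP/cards1P; exists (z |: [set x; y]); apply/setP => B.
    rewrite 2!inE; apply/andP/eqP => [[/MP[BS cB sB] zB]|->].
      have [x' [y' [xy' x'S y'S e ->]]] := triple_of BS cB sB zB.
      by congr (_ |: _); apply: hS => //; rewrite e.
    have nz : z \notin [set x; y] by rewrite !inE negb_or zx.
    have nx : x \notin [set y] by rewrite inE.
    rewrite setU11 !inE; split=> //; apply/and3P; split.
    - by rewrite !subUset !sub1set zS xS.
    - by rewrite cardsU1 nz cards2 xy.
    by rewrite big_setU1 // big_setU1 // big_set1 /= eqxy addrC addxK.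
  apply/eqP; rewrite cards_eq0; apply/eqP/setP => B; rewrite in_set in_set0.
  apply: contraNF ngz => /andP[/MP[BS cB sB] zB].
  have [x [y [xy xS yS e _]]] := triple_of BS cB sB zB.
  rewrite in_supp_gamma -e addx_eq0 xy; apply/exists_inP; exists y => //.
  by rewrite addxK.
transitivity (\sum_(z in S) #|[set B in M | z \in B]|)%N.
  rewrite -sum1dep_card big_mkcondr; apply: eq_bigr => z zS.
  by rewrite through //; case: (_ \in _).
transitivity (\sum_(B in M) #|B|)%N; last first.
  by rewrite (eq_bigr (fun=> 3%N)) ?sum_nat_const 1?mulnC // => B /MP[].
under eq_bigr do rewrite -sum1dep_card big_mkcondr /=.
rewrite exchange_big; apply: eq_bigr => B /MP[BS _ _].
rewrite -big_mkcondr sum1dep_card; apply: eq_card => z; rewrite inE.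
by case zB: (z \in B); rewrite ?andbF ?(subsetP BS).
Qed.

(* Pigeonhole: if [A] is affinely independent of size [n + 1], then
   [B |-> (odd #|B|, \sum_(x in B) x)] is injective on the [2 ^ n.+1] subsets
   of [A], hence takes every value [(false, y)]; but even sums of points of an
   affine hyperplane [dot u x = c] all satisfy [dot u y = 0]. *)
Lemma affine_dim_not_in_hyperplane S u (c : 'F_2) :
  has_affine_dim S n -> u != 0 -> exists2 x, x \in S & dot u x != c.
Proof.
move=> hd u0; apply/exists_inP; apply: contraT; rewrite negb_exists_in.
move/forall_inP => Sc.
have [A /andP[AS Ai] cA] : {A : {set 'F2^n} |
    (A \subset S) && affinely_independent A & #|A| = n.+1}.
  rewrite -hd; have : (0 < #|[pred A : {set 'F2^n} |
    (A \subset S) && affinely_independent A]|)%N.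
    apply/card_gt0P; exists set0; rewrite inE sub0set.
    by apply/forall_inP => x; rewrite inE.
  by case/(eq_bigmax_cond (fun A : {set _} => #|A|)) => A; exists A.
pose h (B : {set 'F2^n}) := (odd #|B|, \sum_(x in B) x).
have odd_sum_D (B C : {set 'F2^n}) : \sum_(x in B) x + \sum_(x in C) x
    = \sum_(x in (B :\: C) :|: (C :\: B)) x.
  rewrite (big_setID C) /= [\sum_(x in C) _](big_setID B) /= [C :&: B]setIC.
  rewrite addrACA addxx add0r -bigU /=.
    by apply: eq_bigl => x; rewrite !inE.
  rewrite -setI_eq0; apply/eqP.
  by apply/setP => x; rewrite !inE; case: (x \in B); case: (x \in C).
(* If [B] and [C] collide, their symmetric difference [E] is nonempty, of even size and of sum 0, so
   any point of [E] is the sum of the odd number of remaining ones, against independence. *)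
have hI : {in powerset A &, injective h}.
  move=> B C; rewrite !inE => BA CA [oBC sBC]; apply: contraTeq Ai => nBC.
  pose E := (B :\: C) :|: (C :\: B).
  have sE : \sum_(x in E) x = 0 by rewrite -odd_sum_D sBC addxx.
  have oE : ~~ odd #|E|.
    rewrite cardsU (_ : _ :&: _ = set0) ?cards0 ?subn0; last first.
      by apply/setP => x; rewrite !inE; case: (x \in B); case: (x \in C).
    move: oBC; rewrite -(cardsID C B) -(cardsID B C) setIC !oddD.
    by case: (odd #|C :&: B|); case: (odd _); case: (odd _).
  have [x xE] : exists x, x \in E.
    apply/set0Pn; apply: contraNneq nBC => E0; apply/eqP/setP => x.
    by move/setP: E0 => /(_ x); rewrite !inE; case: (x \in B); case: (x \in C).
  have EA : E \subset A.
    by rewrite subUset !(subset_trans (subsetDl _ _)).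
  rewrite /affinely_independent negb_forall_in; apply/exists_inP; exists x.
    exact: (subsetP EA).
  rewrite negbK; apply/imsetP; exists (E :\ x).
    by rewrite !inE setSD //=; move: oE; rewrite (cardsD1 x E) xE /= negbK.
  by apply/eqP; rewrite -addx_eq0; move/eqP: sE; rewrite (big_setD1 x xE).
have hT : h @: powerset A = setT.
  apply/eqP; rewrite eqEcard subsetT cardsT (card_in_imset hI) card_powerset cA.
  by rewrite card_prod card_bool card_F2V -expnS /= leqnn.
have [y uy] := dot_neq0 u0.
have : (false, y) \in h @: powerset A by rewrite hT inE.
case/imsetP => B; rewrite inE => BA [eB yB]; move: uy.
rewrite yB dot_sumr (eq_bigr (fun=> c)) => [|x xB]; last first.
  by apply/eqP/negPn/Sc/(subsetP AS)/(subsetP BA).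
rewrite sumr_const -(odd_double_half #|B|) -eB add0n -mul2n mulrnA.
by rewrite -(mulr_natl c) pchar_Zp // mul0r mul0rn.
Qed.

(** * Fourier analysis on F_2^n and the spectrum of Cayley graphs *)

Section Fourier.
Variables (R : numFieldType).
Implicit Types (f g h : 'F2^n -> R).

(** The exponent is the representative 0 or 1 of [dot u x] in nat. *)
Definition chi u x : R := (-1) ^+ dot u x.

Lemma chiD u x y : chi u (x + y) = chi u x * chi u y.
Proof. by rewrite /chi dotDr /= modn2 signr_odd exprD. Qed.

Lemma chiC u x : chi u x = chi x u.
Proof. by rewrite /chi dotC. Qed.

Lemma chi0r u : chi u 0 = 1.
Proof. by rewrite /chi dot0r. Qed.

(** For nonzero [x], translating [u] by some [y] with [dot x y = 1] flips every sign, so the sum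
    equals its own opposite. *)
Lemma chi_orthogonal x : \sum_u chi u x = (2 ^ n)%:R * (x == 0)%:R.
Proof.
case: eqP => [->|/eqP x0].
  rewrite (eq_bigr (fun=> 1)) => [|u _]; last by rewrite chi0r.
  by rewrite sumr_const mulr1 card_F2V.
have [y xy] := dot_neq0 x0; rewrite mulr0.
suff e : \sum_u chi u x = - \sum_u chi u x.
  apply/eqP; have := mulrn_eq0 (\sum_u chi u x) 2.
  by rewrite mulr2n {2}e subrr eqxx.
rewrite {1}(reindex (+%R y)) /=; last exact/onW_bij/bij_addx.
rewrite -sumrN; apply: eq_bigr => u _.
by rewrite !(chiC _ x) chiD /chi xy expr1 mulN1r.
Qed.

Definition fourier f u : R := \sum_x f x * chi u x.
(** This is the usual convolution, since [p + x = p - x]. *)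
Definition conv f g p : R := \sum_x f x * g (p + x).
Definition ind A x : R := (x \in A)%:R.

Lemma fourier_inversion f p :
  \sum_u fourier f u * chi u p = (2 ^ n)%:R * f p.
Proof.
under eq_bigr do rewrite mulr_suml.
rewrite exchange_big (bigD1 p) //= [X in _ + X]big1 ?addr0 => [|x xp].
  under eq_bigr do rewrite -mulrA -chiD addxx.
  by rewrite -mulr_sumr chi_orthogonal eqxx mulr1 mulrC.
under eq_bigr do rewrite -mulrA -chiD.
by rewrite -mulr_sumr chi_orthogonal addx_eq0 (negPf xp) !mulr0.
Qed.

Lemma pow2_neq0 : (2 ^ n)%:R != 0 :> R.
Proof. by rewrite pnatr_eq0 expn_eq0. Qed.

Lemma fourier_inj f g : fourier f =1 fourier g -> f =1 g.
Proof.
move=> e p; apply: (mulfI pow2_neq0); rewrite -!fourier_inversion.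
by apply: eq_bigr => u _; rewrite e.
Qed.

Lemma fourier_conv f g u : fourier (conv f g) u = fourier f u * fourier g u.
Proof.
rewrite /fourier /conv; under eq_bigr do rewrite mulr_suml.
rewrite exchange_big mulr_suml; apply: eq_bigr => x _.
rewrite (reindex (+%R x)) /=; last exact/onW_bij/bij_addx.
rewrite mulr_sumr; apply: eq_bigr => y _.
by rewrite [x + y]addrC addxK chiD [chi u y * _]mulrC mulrACA.
Qed.

Lemma eq_fourier f g : f =1 g -> fourier f =1 fourier g.
Proof. by move=> e u; apply: eq_bigr => x _; rewrite e. Qed.

Lemma fourierD f g u :
  fourier (fun x => f x + g x) u = fourier f u + fourier g u.
Proof. by rewrite -big_split; apply: eq_bigr => x _; rewrite mulrDl. Qed.

Lemma fourierZ a f u : fourier (fun x => a * f x) u = a * fourier f u.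
Proof. by rewrite mulr_sumr; apply: eq_bigr => x _; rewrite mulrA. Qed.

Lemma fourier_delta u : fourier (fun x => (x == 0)%:R) u = 1.
Proof.
rewrite /fourier (bigD1 0) //= eqxx mul1r chi0r big1 ?addr0 // => x /negPf->.
by rewrite mul0r.
Qed.

Lemma fourier_const a u :
  fourier (fun=> a) u = a * (2 ^ n)%:R * (u == 0)%:R.
Proof.
rewrite /fourier -mulr_sumr -mulrA -chi_orthogonal.
by congr (_ * _); apply: eq_bigr => x _; rewrite chiC.
Qed.

(** A transform supported at 0 is that of a constant function, so injectivity of the transform
    applies. *)
Lemma fourier_supp0 f : (forall u, u != 0 -> fourier f u = 0) ->
  forall x, f x = fourier f 0 / (2 ^ n)%:R.
Proof.
move=> f0; apply: fourier_inj => u; rewrite fourier_const divfK ?pow2_neq0 //.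
by case: eqP => [->|/eqP/f0->]; rewrite (mulr1, mulr0).
Qed.

Lemma conv_ind A B p :
  conv (ind A) (ind B) p = #|[set x in A | p + x \in B]|%:R.
Proof.
rewrite -sum1dep_card natr_sum big_mkcond /=; apply: eq_bigr => x _.
by rewrite /ind -natrM mulnb; case: (_ && _).
Qed.

Lemma fourier_ind A u : fourier (ind A) u = \sum_(x in A) chi u x.
Proof.
rewrite big_mkcond; apply: eq_bigr => x _; rewrite /ind.
by case: (x \in A); rewrite (mul0r, mul1r).
Qed.

Lemma fourier_ind0 A : fourier (ind A) 0 = #|A|%:R.
Proof.
rewrite fourier_ind -sum1_card natr_sum; apply: eq_bigr => x _.
by rewrite chiC chi0r.
Qed.

Lemma fourier_ind_card A u :
  fourier (ind A) u = #|A|%:R - (#|[set x in A | dot u x == 1]|).*2%:R.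
Proof.
rewrite fourier_ind -sum1_card -sum1dep_card natr_sum -muln2 natrM natr_sum.
rewrite mulr_suml [X in _ - X]big_mkcondr -sumrB; apply: eq_bigr => x _.
rewrite /chi -F2_neq0; case: (dot u x) => [[|[|m]] //= _].
  by rewrite expr0 subr0.
by rewrite expr1 mul1r; ring.
Qed.

(** The adjacency matrix acts as convolution with [ind D]. Characters are therefore eigenvectors;
    conversely an eigenvector [g] has some nonzero Fourier coefficient at a [u], and cancelling it
    gives the eigenvalue. *)
Lemma eigenvalue_Cay (phi : 'F2^n -> 'F_2) (a : R) :
  reflect (exists u, a = fourier (ind (supp phi)) u)
          (eigenvalue (adjacency_mx R (Cay phi)) a).
Proof.
set D := supp phi; set A := adjacency_mx _ _.
have mulA (v : 'rV_#|{: 'F2^n}|) j :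
    (v *m A) 0 j = conv (fun x => v 0 (enum_rank x)) (ind D) (enum_val j).
  rewrite mxE (reindex enum_rank) /=; last exact/onW_bij/enum_rank_bij.
  by apply: eq_bigr => x _; rewrite mxE enum_rankK CayE addrC.
apply: (iffP eigenvalueP) => [[v vA v0]|[u ->]].
  pose g x := v 0 (enum_rank x).
  have gE : conv g (ind D) =1 (fun x => a * g x).
    by move=> x; rewrite -[x]enum_rankK -mulA vA mxE /g enum_rankK.
  have [u gu] : exists u, fourier g u != 0.
    apply/existsP; apply: contraNT v0; rewrite negb_exists => /forallP g0.
    apply/eqP/rowP => j; rewrite mxE -[j]enum_valK.
    rewrite -[LHS]/(g _) (@fourier_supp0 g) => [|u _]; apply/eqP.
      by have := g0 0; rewrite negbK => /eqP->; rewrite mul0r.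
    by have := g0 u; rewrite negbK.
  exists u; apply: (mulfI gu); rewrite -fourier_conv (eq_fourier gE).
  by rewrite fourierZ mulrC.
exists (\row_j chi u (enum_val j)).
  apply/rowP => j; rewrite mulA !mxE /conv /fourier mulr_suml.
  rewrite (reindex (+%R (enum_val j))) /=; last exact/onW_bij/bij_addx.
  apply: eq_bigr => x _; rewrite mxE enum_rankK addKx chiD.
  by rewrite mulrC [chi u _ * chi u x]mulrC mulrA.
apply/eqP => /rowP/(_ (enum_rank 0)).
by rewrite !mxE enum_rankK chi0r => /eqP; rewrite oner_eq0.
Qed.

End Fourier.

(** * Convolution identities for Sidon sets and k-covers *)

Section SidonFourier.
Variables (R : realFieldType) (S : {set 'F2^n}).
Hypothesis hS : Sidon S.
Local Notation s := (#|S|%:R : R).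
Local Notation D := (supp (gamma S)).
Local Notation shat := (fourier (ind R S)).
Local Notation dhat := (fourier (ind R D)).

Lemma supp_gamma0 : (0 \in D) = false.
Proof. by rewrite in_supp_gamma eqxx. Qed.

Lemma conv_Sidon p :
  conv (ind R S) (ind R S) p = s * (p == 0)%:R + 2 * ind R D p.
Proof.
rewrite conv_ind; case: (eqVneq p 0) => [->|p0].
  rewrite /ind supp_gamma0 mulr1 mulr0 addr0; congr _%:R.
  by apply: eq_card => x; rewrite inE add0r andbb.
by rewrite card_pairs // -mul2n natrM mulr0 add0r.
Qed.

Lemma fourier_supp_gamma u : 2 * dhat u = shat u ^+ 2 - s.
Proof.
rewrite expr2 -fourier_conv (eq_fourier conv_Sidon) fourierD !fourierZ.
rewrite fourier_delta; ring.
Qed.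

Lemma card_neighbours x : #|[set y | Cay (gamma S) x y]| = #|D|.
Proof.
rewrite -(card_imset D (bij_inj (bij_addx x))); apply: eq_card => y.
rewrite in_set CayE; apply/idP/imsetP => [xyD|[z zD ->]]; last by rewrite addKx.
by exists (x + y); rewrite ?addKx.
Qed.

(** The translation [z = x + t] turns common neighbours into pairs of support elements with sum
    [x + y]. *)
Lemma card_common_neighbours x y :
  #|common_neighbours (Cay (gamma S)) x y|%:R
    = conv (ind R D) (ind R D) (x + y).
Proof.
rewrite conv_ind -[in RHS](card_imset _ (bij_inj (bij_addx x))); congr _%:R.
apply: eq_card => z; rewrite in_set !CayE.
apply/andP/imsetP => [[xz yz]|[t]].
  exists (x + z); last by rewrite addKx.
  by rewrite in_set xz addrACA addxx add0r.
by rewrite in_set => /andP[tD xyt] ->; rewrite addKx addrCA addrA.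
Qed.

Lemma conv_triples p : conv (ind R S) (ind R D) p =
  if p \in S then s - 1 else 3 * (mult S p)%:R.
Proof.
rewrite conv_ind; case: ifP => pS.
  rewrite card_triples_in //; have := cardsD1 p S; rewrite pS => ->.
  by rewrite add1n /= mulrS addrC addrK.
by rewrite card_triples_notin ?pS // natrM.
Qed.

Section KCover.
Variables (k : nat).
Hypothesis hk : k_cover k S.
(** The jump of [conv_triples] between points of [S] and other points; it is the value of [dhat u]
    whenever [u] and [shat u] are nonzero. *)
Let theta : R := s - 1 - 3 * k%:R.

Lemma k_cover_conv p :
  conv (ind R S) (ind R D) p = theta * ind R S p + 3 * k%:R.
Proof.
case: hk => _ _ mk; rewrite conv_triples /ind; case: ifPn => [_|/mk->].
  by rewrite mulr1 /theta subrK.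
by rewrite mulr0 add0r.
Qed.

Lemma k_cover_fourier u : shat u * dhat u =
  theta * shat u + 3 * k%:R * (2 ^ n)%:R * (u == 0)%:R.
Proof.
rewrite -fourier_conv (eq_fourier k_cover_conv).
by rewrite fourierD fourierZ fourier_const.
Qed.

(** This is [k_cover_fourier] at [u = 0], where [2 * dhat 0 = s ^+ 2 - s]. *)
Lemma k_cover_card : 6 * k%:R * ((2 ^ n)%:R - s) = s * (s - 1) * (s - 2).
Proof.
have := k_cover_fourier 0; have := fourier_supp_gamma 0.
rewrite !fourier_ind0 eqxx mulr1 => e1 e2.
have : s * (2 * #|D|%:R) = 2 * (s * #|D|%:R) by ring.
by rewrite e1 e2 /theta => e; lra.
Qed.

(** The triple convolution of [S], [S] and [D] is expanded in two ways, convolving first [S] with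
    [S] or first [S] with [D], and compared on transforms. *)
Lemma k_cover_conv2 p : p != 0 -> 2 * conv (ind R D) (ind R D) p =
  (2 * theta - s) * ind R D p + 3 * k%:R * s.
Proof.
move=> p0.
have e q : s * ind R D q + 2 * conv (ind R D) (ind R D) q =
    theta * (s * (q == 0)%:R + 2 * ind R D q) + 3 * k%:R * s.
  move: q; apply: fourier_inj => u.
  rewrite !fourierD !fourierZ fourierD fourier_conv fourier_const !fourierZ.
  have d0 : shat u * (u == 0)%:R = s * (u == 0)%:R.
    by case: eqP => [->|_]; rewrite ?fourier_ind0 // !mulr0.
  have e1 := fourier_supp_gamma u; have e2 := k_cover_fourier u.
  transitivity (shat u * (shat u * dhat u)).
    have sq : shat u * shat u = 2 * dhat u + s by rewrite e1; ring.
    by rewrite [RHS]mulrA sq; ring.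
  rewrite e2 e1 fourier_delta.
  rewrite mulrDr [shat u * (_ * (u == 0)%:R)]mulrCA d0; ring.
have := e p; rewrite (negPf p0) mulr0 add0r => {}e; lra.
Qed.

Lemma k_cover_common_neighbours x y : x != y ->
  2 * #|common_neighbours (Cay (gamma S)) x y|%:R =
  (2 * theta - s) * ind R D (x + y) + 3 * k%:R * s.
Proof.
by move=> xy; rewrite card_common_neighbours k_cover_conv2 ?addx_eq0.
Qed.

End KCover.
End SidonFourier.

(** * Strong regularity of the graph of a k-cover *)

Lemma card_supp_gamma S : Sidon S -> #|supp (gamma S)| = 'C(#|S|, 2).
Proof.
move=> hS; have := fourier_supp_gamma rat hS 0; rewrite !fourier_ind0.
move/(congr1 (fun a => a + #|S|%:R)).
rewrite subrK -natrM -natrD -natrX => /eqP.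
by rewrite eqr_nat bin2 => /eqP e; case: #|S| e => [|m] /=; lia.
Qed.

(** The number of common neighbours depends only on adjacency, so one adjacent and one non-adjacent
    pair provide both parameters. *)
Lemma k_cover_strongly_regular S k x0 y0 x1 y1 : Sidon S -> k_cover k S ->
    x0 != y0 -> Cay (gamma S) x0 y0 -> x1 != y1 -> ~~ Cay (gamma S) x1 y1 ->
  strongly_regular (Cay (gamma S)) (2 ^ n) 'C(#|S|, 2)
    #|common_neighbours (Cay (gamma S)) x0 y0|
    #|common_neighbours (Cay (gamma S)) x1 y1|.
Proof.
move=> hS hk n0 a0 n1 a1.
have E x y x' y' : x != y -> x' != y' ->
    Cay (gamma S) x y = Cay (gamma S) x' y' ->
    #|common_neighbours (Cay (gamma S)) x y|
      = #|common_neighbours (Cay (gamma S)) x' y'|.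
  rewrite !CayE => xy xy' e; apply/eqP; rewrite -(eqr_nat rat) -subr_eq0.
  have := k_cover_common_neighbours rat hS hk xy.
  have := k_cover_common_neighbours rat hS hk xy'.
  rewrite /ind e => <- e2; apply/eqP; lra.
split; first exact: card_F2V.
- by move=> x; rewrite card_neighbours card_supp_gamma.
- by move=> x y xy a; apply: E => //; rewrite a a0.
by move=> x y xy a; apply: E => //; rewrite (negPf a) (negPf a1).
Qed.

(** * Fourier forms of completeness, k-covers, separability and strong regularity *)

Lemma not_completeP (e : rel 'F2^n) : ~ complete_graph e ->
  exists x y, x != y /\ ~~ e x y.
Proof.
move=> nc; have /existsP[[x y] /andP[]] :
    [exists q : 'F2^n * 'F2^n, (q.1 != q.2) && ~~ e q.1 q.2].
  apply: contra_notT nc; rewrite negb_exists => /forallP h x y xy.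
  by have := h (x, y); rewrite /= xy negbK.
by exists x, y.
Qed.

Lemma fourier_complete (R : realFieldType) S u :
  complete_graph (Cay (gamma S)) -> u != 0 ->
  fourier (ind R (supp (gamma S))) u = -1.
Proof.
move=> hc u0; have e x : ind R (supp (gamma S)) x = 1 + -1 * (x == 0)%:R.
  rewrite /ind; case: (eqVneq x 0) => [->|x0].
    by rewrite supp_gamma0 mulr1 subrr.
  by rewrite -[x]add0r -CayE hc 1?eq_sym // mulr0 addr0.
rewrite (eq_fourier e) fourierD fourierZ fourier_const fourier_delta.
by rewrite (negPf u0) mulr0 add0r mulr1.
Qed.

(** Subtracting [theta] times the delta at 0 leaves a transform supported at 0; hence [ind D] is
    constant off 0, and the constant is 1 because [D] is nonempty. *)
Lemma fourier_constant_complete (R : realFieldType) S (theta : R) :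
    (1 < #|S|)%N ->
    (forall u, u != 0 -> fourier (ind R (supp (gamma S))) u = theta) ->
  forall p, p != 0 -> p \in supp (gamma S).
Proof.
move=> /card_supp_gamma_pos[q qD] hth p p0.
set D := supp _ in hth qD *.
have := @fourier_supp0 R (fun x => ind R D x + - theta * (x == 0)%:R).
set C := (X in X / _) => /(_ _) hC.
have {}hC x : ind R D x + - theta * (x == 0)%:R = C / (2 ^ n)%:R.
  apply: hC => u u0; rewrite fourierD fourierZ fourier_delta hth //; ring.
have q0 : q != 0 by apply: contraTneq qD => ->; rewrite supp_gamma0.
have := hC p; rewrite -(hC q) /ind (negPf p0) (negPf q0) qD !mulr0 !addr0.
by case: (p \in D) => // /eqP; rewrite eq_sym oner_eq0.
Qed.

(** The transform is [#|S| - 2 * m] with [m] the number of points where [dot u x = 1]; equality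
    would force [m = 0] or [m = #|S|], placing [S] in a hyperplane. *)
Lemma fourier_affine_dim (R : realFieldType) S u :
  has_affine_dim S n -> u != 0 ->
  fourier (ind R S) u ^+ 2 != #|S|%:R ^+ 2.
Proof.
move=> hd u0; rewrite fourier_ind_card.
set m := #|[set x in S | _]|; apply/negP => /eqP e.
have : (m%:R * (m%:R - #|S|%:R) : R) == 0.
  by apply/eqP; move: e; rewrite -muln2 natrM; lra.
rewrite mulf_eq0 pnatr_eq0 subr_eq0 eqr_nat => /orP[]; last first.
  move=> /eqP mS; have [x xS] := affine_dim_not_in_hyperplane 1 hd u0.
  have /eqP e2 : [set x in S | dot u x == 1] == S.
    rewrite eqEcard -mS leqnn andbT; apply/subsetP => y.
    by rewrite inE => /andP[].
  by rewrite -e2 inE in xS; case/andP: xS => _ ->.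
rewrite cards_eq0 => /eqP/setP m0.
have [x xS] := affine_dim_not_in_hyperplane 0 hd u0.
by rewrite F2_neq0 => ux; have := m0 x; rewrite !inE xS ux.
Qed.

(** The function [f] below has a transform supported at 0, so it is constant; off [S] it is three
    times the multiplicity. *)
Lemma k_cover_of_fourier (R : realFieldType) S (theta : R) :
    Sidon S -> has_affine_dim S n -> (0 < #|S|)%N ->
    (forall u, u != 0 -> fourier (ind R S) u
       * fourier (ind R (supp (gamma S))) u = theta * fourier (ind R S) u) ->
  exists k, k_cover k S.
Proof.
move=> hS hd s0 hth; set D := supp _ in hth.
(* With no point outside [S] the covering condition is vacuous, and any positive [k] serves. *)
have [/eqP ST|] := boolP (S == setT).
  by exists 1%N; split=> // p; rewrite ST inE.
rewrite -subTset => /subsetPn[p0 _ p0S].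
pose f x := conv (ind R S) (ind R D) x + - theta * ind R S x.
have f0 u : u != 0 -> fourier f u = 0.
  by move=> u0; rewrite fourierD fourierZ fourier_conv hth //; ring.
have fE := fourier_supp0 f0.
have fS p : p \notin S -> f p = 3 * (mult S p)%:R.
  move=> pS; rewrite /f conv_triples // (negPf pS) /ind (negPf pS).
  by rewrite mulr0 addr0.
exists (mult S p0); split=> // [|p pS]; last first.
  by apply/eqP; rewrite -(eqr_nat R); apply/eqP; have := fS p pS;
    have := fS p0 p0S; rewrite !fE; lra.
(* Zero multiplicity would give [theta = dhat 0]. Affine dimension then forces the transform of [S]
   to vanish off 0, so [ind S] would be constant, although [S] is nonempty and misses [p0]. *)
rewrite lt0n; apply/negP => /eqP m0.
have fz : fourier f 0 = 0.
  have := fS p0 p0S; rewrite m0 mulr0 fE => /eqP.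
  by rewrite mulf_eq0 invr_eq0 (negPf (pow2_neq0 R)) orbF => /eqP.
have sR : #|S|%:R != 0 :> R by rewrite pnatr_eq0 -lt0n.
have th0 : theta = fourier (ind R D) 0.
  apply: (mulfI sR); move: fz.
  rewrite fourierD fourierZ fourier_conv (fourier_ind0 R S); lra.
have S0 u : u != 0 -> fourier (ind R S) u = 0.
  move=> u0; apply/eqP; apply: contraT => Su.
  have := hth u u0; rewrite mulrC => /(mulIf Su) Du.
  have := fourier_affine_dim R hd u0.
  have := fourier_supp_gamma R hS u; have := fourier_supp_gamma R hS 0.
  rewrite -/D Du th0 (fourier_ind0 R S) => -> e /eqP[].
  by move: e; lra.
have SE := fourier_supp0 S0.
have := SE p0.
have [x xS] : exists x, x \in S by apply/set0Pn; rewrite -card_gt0.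
by rewrite -(SE x) /ind xS (negPf p0S) => /eqP; rewrite eq_sym oner_eq0.
Qed.

(** Affine hyperplanes are the level sets of [dot u] for nonzero [u], and the transform at [u] is
    the difference of the sizes of the two parts of [S]. *)
Lemma separableP (R : realFieldType) S :
  separable S <-> exists2 u, u != 0 & fourier (ind R S) u = 0.
Proof.
have half u : fourier (ind R S) u = 0 <->
    #|[set x in S | dot u x == 1%R]|.*2 = #|S|.
  rewrite fourier_ind_card; split=> [/eqP|->]; last by rewrite subrr.
  by rewrite subr_eq0 eqr_nat eq_sym => /eqP.
have halfC u c : #|[set x in S | dot u x == c]|.*2 = #|S| <->
    fourier (ind R S) u = 0.
  rewrite half; have := cardsID [set x | dot u x == 1] S.
  have -> : S :&: [set x | dot u x == 1] = [set x in S | dot u x == 1].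
    by apply/setP => x; rewrite !inE.
  have -> : S :\: [set x | dot u x == 1] = [set x in S | dot u x == 0].
    by apply/setP => x; rewrite !inE andbC -F2_neq0 negbK.
  have [->|->] : c = 0 \/ c = 1; last by [].
    by case: c => [[|[|m]] // i]; [left | right]; apply/val_inj.
  move=> <-; set a := #|[set x in S | dot u x == 1]|.
  by set b := #|[set x in S | dot u x == 0]|; lia.
split=> [[H [[U [v [dU ->]]] cH]]|[u u0 Su]].
  have [w wU] : exists w, w \notin U.
    apply/existsP; rewrite -negb_forall; apply/forallP => hU.
    suff : \dim U = n by lia.
    have -> : U = fullv by apply/vspaceP => x; rewrite hU memvf.
    by rewrite dimvf /dim /= mul1n.
  have UwT : (U + <[w]> = fullv)%VS.
    apply/eqP; rewrite eqEdim subvf dimvf /dim /= mul1n.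
    suff : (\dim U < \dim (U + <[w]>))%N by rewrite dU.
    rewrite ltn_neqAle dimvS ?addvSl // andbT; apply: contraNneq wU => e.
    have /eqP -> : U == (U + <[w]>)%VS by rewrite eqEdim addvSl e leqnn.
    exact/(subvP (addvSr _ _))/memv_line.
  have Uw x : (x + w \in U) = (x \notin U).
    have [xU|xU] := boolP (x \in U).
      by rewrite rpredDl // (negPf wU).
    have : x \in (U + <[w]>)%VS by rewrite UwT memvf.
    case/memv_addP => y yU [_ /vlineP[a ->] ex]; rewrite ex.
    have a0 : a != 0 by apply: contraNneq xU => a0; rewrite ex a0 scale0r addr0.
    by rewrite F2_neq0 in a0; rewrite (eqP a0) scale1r addxK.
  (* As [U] has index 2, membership in its complement is a linear form, represented by the vector
     [u] of its values on the standard basis. *)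
  pose h x : 'F_2 := (x \notin U)%:R.
  have hD : {morph h : x y / x + y}.
    move=> x y; rewrite /h; have [xU|] := boolP (x \in U).
      by rewrite rpredDl // add0r.
    rewrite -Uw => xwU; have [yU|] := boolP (y \in U).
      by rewrite rpredDr // -Uw xwU addr0.
    rewrite -Uw => ywU; have -> : x + y = (x + w) + (y + w).
      by rewrite addrACA addxx addr0.
    by rewrite rpredD //; apply/val_inj.
  have h0 : h 0 = 0 by rewrite /h mem0v.
  have hZ a x : h (a *: x) = a * h x.
    have [->|] := eqVneq a 0; first by rewrite scale0r mul0r.
    by rewrite F2_neq0 => /eqP->; rewrite scale1r mul1r.
  pose u : 'F2^n := \row_i h (delta_mx 0 i).
  have uE x : dot u x = h x.
    rewrite {2}[x]row_sum_delta (big_morph h hD h0) dotE.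
    by apply: eq_bigr => i _; rewrite mxE hZ mulrC.
  exists u.
    apply: contraNneq wU => u0; have := uE w; rewrite u0 dotC dot0r /h.
    by case: (w \in U).
  apply/(halfC u (dot u v)); rewrite -cH; congr _.*2.
  apply: eq_card => x; rewrite !inE andbC; congr (_ && _).
  have dB : dot u (x - v) = dot u x - dot u v.
    by rewrite /dot linearB mulmxBr !mxE.
  rewrite -subr_eq0 -dB uE /h.
  by case: (_ \in _).
have [w uw] := dot_neq0 u0.
(* The kernel of this nonzero linear form has codimension 1 by rank-nullity. *)
pose f : 'Hom('F2^n, 'rV['F_2]_1) := linfun (mulmxr u^T).
have fE x : f x = 0 <-> dot u x = 0.
  rewrite lfunE /= dotC /dot; split=> [->|e]; first by rewrite mxE.
  by apply/rowP => i; rewrite (ord1 i) e mxE.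
exists [set x | x - 0 \in lker f]; split.
  exists (lker f), 0; split=> //.
  have := limg_ker_dim f fullv; rewrite capfv dimvf [dim _]mul1n.
  suff -> : \dim (f @: fullv) = 1%N by rewrite addn1.
  apply/eqP; rewrite eqn_leq; apply/andP; split.
    by rewrite (leq_trans (dimvS (subvf _))) // dimvf.
  rewrite lt0n dimv_eq0; apply/negP => /eqP i0.
  have : f w \in (f @: fullv)%VS by rewrite memv_img ?memvf.
  rewrite i0 memv0 => /eqP/fE; rewrite uw => /eqP.
  by rewrite oner_eq0.
have /(halfC u 0) := Su => <-; congr _.*2; apply: eq_card => x.
rewrite !inE subr0 memv_ker andbC; congr (_ && _).
by apply/eqP/eqP => /fE.
Qed.

(** The matrix identity A^2 = (r - mu) I + (lam - mu) A + mu J, read as convolutions on the row of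
    vertex 0. *)
Lemma srg_conv (R : realFieldType) S v r lam mu :
    strongly_regular (Cay (gamma S)) v r lam mu ->
  let D := supp (gamma S) in
  conv (ind R D) (ind R D) =1 fun p =>
    (r%:R - mu%:R) * (p == 0)%:R + ((lam%:R - mu%:R) * ind R D p + mu%:R).
Proof.
case=> _ hr hl hm D p; rewrite -[p]add0r -card_common_neighbours add0r.
have [->|p0] := eqVneq p 0.
  rewrite /ind supp_gamma0 mulr0 add0r mulr1 subrK -(hr 0); congr _%:R.
  by apply: eq_card => z; rewrite !in_set andbb.
have ep : (0 != p) by rewrite eq_sym.
rewrite mulr0 add0r /ind; case: (boolP (p \in D)) => pD.
  by rewrite hl // ?CayE ?add0r // mulr1 subrK.
by rewrite hm // ?CayE ?add0r // mulr0 add0r.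
Qed.

(** * Consequences of the number of eigenvalues *)

Section Eigenvalues.
Variables (R : realFieldType) (S : {set 'F2^n}) (d : nat).
Hypothesis hd : has_num_eigenvalues (adjacency_mx R (Cay (gamma S))) d.
Local Notation dhat := (fourier (ind R (supp (gamma S)))).

(** Affine dimension separates [dhat 0] from every other [dhat u], which leaves a single value for
    the latter. *)
Lemma two_eigenvalues : Sidon S -> has_affine_dim S n -> d = 2 ->
  exists theta, forall u, u != 0 -> dhat u = theta.
Proof.
move=> hS hdim d2; case: hd => L [uL sL eL].
have inL u : dhat u \in L by rewrite -eL; apply/eigenvalue_Cay; exists u.
have neq u : u != 0 -> dhat u != dhat 0.
  move=> u0; apply: contraNneq (fourier_affine_dim R hdim u0) => e.
  have := fourier_supp_gamma R hS u; have := fourier_supp_gamma R hS 0.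
  by rewrite e (fourier_ind0 R S) => -> e1; apply/eqP; lra.
have := mem_rem_uniq (dhat 0) uL; have := perm_to_rem (inL 0) => /perm_size.
rewrite sL d2; case: (rem _ _) => [|b [|]] // _ rL.
exists b => u u0; have := rL (dhat u).
by rewrite !inE inL andbT neq // => /eqP.
Qed.

Lemma three_eigenvalues theta : (2 < d)%N ->
  exists2 u, u != 0 & dhat u != theta.
Proof.
move=> d3; apply/exists_inP; apply: contraT; rewrite negb_exists_in.
move/forall_inP => ht; case: hd => L [uL sL eL].
suff : (size L <= size [:: dhat 0; theta])%N by rewrite sL leqNgt d3.
apply: uniq_leq_size => // a; rewrite -eL => /eigenvalue_Cay[u ->].
rewrite !inE; have [->|u0] := eqVneq u 0; first by rewrite eqxx.
by have := ht u u0; rewrite negbK => ->; rewrite orbT.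
Qed.

End Eigenvalues.

End BinarySpace.

(* Both factors of [(t ^ 2 + 2 + t) * (t ^ 2 + 2 - t)] are powers of two, so the
   smaller one divides their difference [2 * t]. *)
Lemma quartic_eq_pow2 (n t : nat) : (t ^ 4 + 3 * t ^ 2 + 4 = 2 ^ n.+1)%N ->
  (n, t) \in [:: (1, 0); (2, 1); (4, 2)]%N.
Proof.
(* This bound makes the truncated subtraction in the second factor exact. *)
move=> e; have t_le : (t <= t ^ 2 + 2)%N by nia.
have e2 : ((t ^ 2 + 2 + t) * (t ^ 2 + 2 - t) = 2 ^ n.+1)%N.
  by rewrite mulnC -subn_sqr -e; nia.
have /(dvdn_pfactor _ _ (isT : prime 2))[a _ ea] :
  (t ^ 2 + 2 + t %| 2 ^ n.+1)%N by rewrite -e2 dvdn_mulr.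
have /(dvdn_pfactor _ _ (isT : prime 2))[b _ eb] :
  (t ^ 2 + 2 - t %| 2 ^ n.+1)%N by rewrite -e2 dvdn_mull.
have ba : (b <= a)%N by rewrite -(leq_exp2l _ _ (isT : 1 < 2)%N) -ea -eb; lia.
have : (t ^ 2 + 2 - t %| 2 * t)%N.
  have -> : (2 * t = t ^ 2 + 2 + t - (t ^ 2 + 2 - t))%N by lia.
  by rewrite dvdn_sub // ea eb dvdn_exp2l.
have [t0 _|t0 /dvdn_leq] := posnP t; last first.
  (* Divisibility gives [t ^ 2 + 2 - t <= 2 * t], that is (t - 1)(t - 2) <= 0. *)
  rewrite muln_gt0 t0 => /(_ isT) tt; have t2 : (t <= 2)%N by nia.
  case: t t2 t0 e {t_le e2 ea eb tt} => [|[|[|]]] // _ _ e.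
    by case: (expnI (isT : 1 < 2)%N (e : 2 ^ 3 = _)%N) => <-.
  by case: (expnI (isT : 1 < 2)%N (e : 2 ^ 5 = _)%N) => <-.
rewrite t0 in e *.
by case: (expnI (isT : 1 < 2)%N (e : 2 ^ 2 = _)%N) => <-.
Qed.

(** * Deduction of the three assertions from the Fourier criteria *)

Theorem theorem1p5 (R : rcfType) (n : nat) (S : {set 'F2^n})
    (hn : (1 <= n)%N) (hS : Sidon S) (hdim : has_affine_dim S n)
    (hs : (1 < #|S|)%N) :
  [/\ has_num_eigenvalues (adjacency_mx R (Cay (gamma S))) 2 ->
        n \in [:: 1%N; 2%N; 4%N] /\
        (n <> 1%N ->
          (exists k, k_cover k S) /\
          (n, #|S|) \in [:: (2%N, 3%N); (4%N, 6%N)]),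
      (exists2 d, (3 <= d)%N &
         has_num_eigenvalues (adjacency_mx R (Cay (gamma S))) d) ->
        ((exists k, k_cover k S) <->
         (exists v r lam mu, strongly_regular (Cay (gamma S)) v r lam mu) /\
         separable S)
    & forall k, k_cover k S -> ~ complete_graph (Cay (gamma S)) ->
        let s : rat := #|S|%:R in
        exists lam mu : nat,
          [/\ strongly_regular (Cay (gamma S)) (2 ^ n) 'C(#|S|, 2) lam mu,
              lam%:R = 3 * k%:R / 2 *
                       ((2 ^+ n.+1 + s ^+ 2 * (s - 3)) / (s * (s - 1)))
              /\ mu%:R = 3 * k%:R / 2 * s
            & lam%:R = (s - 2) * (s ^+ 3 - 3 * s ^+ 2 + 2 ^+ n.+1)
                       / (4 * (2 ^+ n - s))
              /\ mu%:R = s ^+ 2 * (s - 1) * (s - 2) / (4 * (2 ^+ n - s))]].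
Proof.
set D := supp (gamma S).
split=> [h2|[d d3 hd]|k hk nc].
- have [theta hth] := two_eigenvalues h2 hS hdim erefl.
  have hD := fourier_constant_complete hs hth.
  have hc : complete_graph (Cay (gamma S)).
    by move=> x y xy; rewrite CayE hD // addx_eq0.
  have cD : (#|D|.+1 = 2 ^ n)%N.
    rewrite -card_F2V -cardsT (cardsD1 0 setT) in_setT add1n; congr _.+1.
    apply: eq_card => p; rewrite in_setD1 in_setT andbT.
    by apply/idP/idP => [|/hD //]; rewrite in_supp_gamma => /andP[].
  have [u u0] : exists u : 'F2^n, u != 0.
    by exists (const_mx 1); apply/rV0Pn; exists (Ordinal hn); rewrite mxE.
  have Du := fourier_complete R hc u0.
  (* Since [dhat u = -1], the integer [#|S| - m] has square [#|S| - 2]; [t] is its absolute value,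
     whence the case split on its sign. *)
  have [t ht] : exists t, (t ^ 2 + 2 = #|S|)%N.
    have := fourier_supp_gamma R hS u; rewrite Du fourier_ind_card.
    set m := #|[set x in S | _]|.*2 => e.
    have [mS|/ltnW mS] := leqP m #|S|.
      exists (#|S| - m)%N; apply/eqP; rewrite -(eqr_nat R) natrD natrX natrB //.
      by apply/eqP; lra.
    exists (m - #|S|)%N; apply/eqP; rewrite -(eqr_nat R) natrD natrX natrB //.
    by apply/eqP; lra.
  (* Two counts of [D] agree: [2 ^ n - 1] and half of [#|S| ^ 2 - #|S|]. *)
  have e0 : (#|S| ^ 2 + 2 = 2 * 2 ^ n + #|S|)%N.
    apply/eqP; rewrite -(eqr_nat R) -cD.
    rewrite !natrD natrX natrM -[#|D|.+1]addn1 natrD.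
    have := fourier_supp_gamma R hS 0; rewrite !fourier_ind0 => e.
    by apply/eqP; lra.
  have /quartic_eq_pow2 : (t ^ 4 + 3 * t ^ 2 + 4 = 2 ^ n.+1)%N.
    move: e0; rewrite -ht (expnS 2 n) sqrnD.
    by rewrite (_ : t ^ 4 = (t ^ 2) ^ 2)%N -?expnM //; lia.
  rewrite -ht !inE !xpair_eqE => ent.
  split; first by case/or3P: ent => /andP[-> _]; rewrite ?orbT.
  move=> n1; split.
    apply: (@k_cover_of_fourier _ R S theta) => // [|v v0].
      exact: ltnW.
    by rewrite hth // mulrC.
  by case/or3P: ent => /andP[/eqP ? /eqP->] //; subst n.
(* The value -1 is what a complete graph would give at every nonzero frequency. *)
- have [v v0 nv] := three_eigenvalues hd (-1) d3.
  have nc : ~ complete_graph (Cay (gamma S)).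
    by move=> hc; move: nv; rewrite fourier_complete ?eqxx.
  have [q qD] := card_supp_gamma_pos hs.
  split=> [[k hk]|[[v' [r [lam [mu hsrg]]]] /(separableP R)[u0 u00 Su0]]].
    split.
      have [x [y [xy nxy]]] := not_completeP nc.
      exists (2 ^ n)%N, 'C(#|S|, 2), #|common_neighbours (Cay (gamma S)) 0 q|,
        #|common_neighbours (Cay (gamma S)) x y|.
      apply: k_cover_strongly_regular hS hk _ _ xy nxy.
        by rewrite eq_sym; apply: contraTneq qD => ->; rewrite supp_gamma0.
      by rewrite CayE add0r.
    apply/(separableP R).
    (* Where [dhat u] differs from this constant, [k_cover_fourier] makes the transform of [S]
       vanish. *)
    have [u u0 Du] := three_eigenvalues hd (#|S|%:R - 1 - 3 * k%:R) d3.
    exists u => //; have := k_cover_fourier R hS hk u.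
    rewrite (negPf u0) mulr0 addr0 mulrC => e.
    by apply/eqP; apply: contraNT Du => Su; apply/eqP/(mulIf Su).
  have hq u : u != 0 -> fourier (ind R D) u ^+ 2 =
      (r%:R - mu%:R) + (lam%:R - mu%:R) * fourier (ind R D) u.
    move=> un0; rewrite expr2 -fourier_conv (eq_fourier (srg_conv R hsrg)).
    rewrite !fourierD !fourierZ fourier_delta fourier_const (negPf un0).
    by rewrite mulr0 addr0 mulr1.
  (* By Vieta, the other root of the quadratic [hq]. *)
  pose theta : R := lam%:R - mu%:R - fourier (ind R D) u0.
  apply: (@k_cover_of_fourier _ R S theta) => // [|u un0]; first exact: ltnW.
  apply/eqP; rewrite [X in _ == X]mulrC -subr_eq0 -mulrBr.
  have := fourier_supp_gamma R hS u0; rewrite Su0 -/D => e0.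
  have := fourier_supp_gamma R hS u; rewrite -/D => e.
  have /eqP : fourier (ind R S) u ^+ 2 * (fourier (ind R D) u - theta) = 0.
    have -> : fourier (ind R S) u ^+ 2 =
      2 * (fourier (ind R D) u - fourier (ind R D) u0) by lra.
    by have := hq u un0; have := hq u0 u00; rewrite /theta; lra.
  by rewrite !mulf_eq0 orbb.
have [q qD] := card_supp_gamma_pos hs.
have q0 : 0 != q.
  by rewrite eq_sym; apply: contraTneq qD => ->; rewrite supp_gamma0.
have aq : Cay (gamma S) 0 q by rewrite CayE add0r.
have [x [y [xy nxy]]] := not_completeP nc.
(* If [S] were the whole space the graph would be complete; this keeps [2 ^+ n - s] nonzero. *)
have Sn : (#|S| < 2 ^ n)%N.
  rewrite -card_F2V -cardsT; apply: proper_card; rewrite properT.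
  apply: contraNneq nxy => ST; rewrite CayE in_supp_gamma addx_eq0 xy ST.
  by apply/exists_inP; exists 0; rewrite inE.
move=> s; exists #|common_neighbours (Cay (gamma S)) 0 q|,
  #|common_neighbours (Cay (gamma S)) x y|.
have hlam := k_cover_common_neighbours rat hS hk q0.
have hmu := k_cover_common_neighbours rat hS hk xy.
(* This relation between [k], [s] and [2 ^ n] converts the counts into both forms of the
   parameters. *)
have hcard := k_cover_card rat hS hk.
rewrite /ind -CayE aq in hlam; rewrite /ind -CayE (negPf nxy) in hmu.
rewrite -/s mulr1 in hlam; rewrite -/s mulr0 add0r in hmu.
rewrite -/s natrX in hcard.
move: hlam hmu; set lam : rat := _%:R; set mu : rat := #|_|%:R => hlam hmu.
have s0 : s != 0 by rewrite pnatr_eq0; lia.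
have s1 : s - 1 != 0 by rewrite subr_eq0 pnatr_eq1; lia.
have sn : 2 ^+ n - s != 0 by rewrite subr_eq0 -natrX /s eqr_nat; lia.
have nz1 : s * (s - 1) != 0 by rewrite mulf_neq0.
have nz2 : 4 * (2 ^+ n - s) != 0 by rewrite mulf_neq0.
split; first exact: (k_cover_strongly_regular hS hk q0 aq xy nxy).
  split; last lra.
  by rewrite mulrA; apply: (canRL (mulfK nz1)); rewrite exprS; nra.
by split; apply: (canRL (mulfK nz2)); rewrite ?exprS; nra.
Qed.
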